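(* For every tree $T$, $$a(T)-\alpha(T)\le \frac{\mu(T)}{2}-\frac12 .$$
   Context: All graphs are finite, undirected, without loops or multiple edges. For a graph $G$, $m(G)$ is its number of edges, $\alpha(G)$ is its independence number (maximum size of a set of pairwise non-adjacent vertices), and $\mu(G)$ is its matching number (maximum size of a set of edges no two of which share a vertex). If $d_1\le d_2\le\cdots\le d_n$ is the degree sequence of $G$, the annihilation number $a(G)$ is the largest integer $k$ such that $\sum_{i=1}^k d_i\le m(G)$.
   Formalization: The tree T is assumed to have at least two vertices; for the one-vertex tree a = α = 1 and μ = 0, so the stated inequality would read 0 ≤ −1/2 and fails. *)

(* Defs.v *)
From mathcomp Require Import all_boot.

Set Implicit Arguments.
Unset Strict Implicit.
Unset Printing Implicit Defensive.

(* A finite simple graph is a symmetric irreflexive relation [e] on a finite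
   vertex type [V]. *)
Definition simple_graph (V : finType) (e : rel V) : Prop :=
  symmetric e /\ irreflexive e.

Definition edges (V : finType) (e : rel V) : {set {set V}} :=
  [set [set p.1; p.2] | p : V * V & e p.1 p.2].

Definition num_edges (V : finType) (e : rel V) : nat := #|edges e|.

Definition connected_graph (V : finType) (e : rel V) : Prop :=
  0 < #|V| /\ forall x y : V, connect e x y.

(* [ucycle e c] also holds for the empty sequence and for the two ends of an
   edge, hence the bound on [size c]. *)
Definition acyclic (V : finType) (e : rel V) : Prop :=
  forall c : seq V, 2 < size c -> ~ ucycle e c.

Definition tree (V : finType) (e : rel V) : Prop :=
  [/\ simple_graph e, connected_graph e & acyclic e].

Definition degree (V : finType) (e : rel V) (x : V) : nat :=
  #|[set y | e x y]|.

Definition degree_sequence (V : finType) (e : rel V) : seq nat :=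
  sort leq [seq degree e x | x <- enum V].

Definition independent (V : finType) (e : rel V) (S : {set V}) : bool :=
  [forall x in S, forall y in S, ~~ e x y].

Definition independence_number (V : finType) (e : rel V) : nat :=
  \max_(S : {set V} | independent e S) #|S|.

Definition matching (V : finType) (e : rel V) (M : {set {set V}}) : bool :=
  (M \subset edges e) && trivIset M.

Definition matching_number (V : finType) (e : rel V) : nat :=
  \max_(M : {set {set V}} | matching e M) #|M|.

(* The index [k] ranges over 0, ..., #|V|, and k = 0 always qualifies. *)
Definition annihilation_number (V : finType) (e : rel V) : nat :=
  \max_(k < #|V|.+1 |
        \sum_(d <- take k (degree_sequence e)) d <= num_edges e) k.

(* Main.v *)
(** Split the vertices into the set A of the k = a(T) vertices of smallest
    degree and its complement B.  Summing degrees over A counts each edge once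
    for every end in A, so "degree sum at most m" means e(A) <= e(B).  As T has
    an edge, B is nonempty, and acyclicity gives e(B) <= |B| - 1.  A matching
    has at most e(A) edges inside A and at most |B| edges meeting B, so
    mu <= 2|B| - 1.  Koenig's inequality n <= alpha + mu then concludes. *)
Require Import Defs.
From mathcomp Require Import all_boot all_order all_algebra.
From mathcomp Require Import zify lra.

Set Implicit Arguments.
Unset Strict Implicit.
Unset Printing Implicit Defensive.

Import GRing.Theory Num.Theory.

Section Graph.

Variables (V : finType) (e : rel V).

(** * Incidence counts for edges and matchings relative to a vertex set *)

Definition edges_in (W : {set V}) : {set {set V}} :=
  [set E in edges e | E \subset W].

Definition nbrs_in (W : {set V}) (x : V) : {set V} := [set y in W | e x y].

Lemma edgeP (E : {set V}) :
  reflect (exists x y, e x y /\ E = [set x; y]) (E \in edges e).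
Proof.
apply: (iffP imsetP) => [[[x y] exy ->]|[x [y [exy ->]]]].
  by move: exy; rewrite inE; exists x, y.
by exists (x, y); rewrite ?inE.
Qed.

Lemma mem_edges (x y : V) : e x y -> [set x; y] \in edges e.
Proof. by move=> exy; apply/edgeP; exists x, y. Qed.

Hypotheses (e_sym : symmetric e) (e_irr : irreflexive e).

Lemma edge_neq (x y : V) : e x y -> x != y.
Proof. by apply: contraTneq => ->; rewrite e_irr. Qed.

Lemma card_edge (E : {set V}) : E \in edges e -> #|E| = 2.
Proof. by case/edgeP => x [y [/edge_neq xy ->]]; rewrite cards2 xy. Qed.

Lemma edges_at (W : {set V}) (x : V) : x \in W ->
  #|[set E in edges_in W | x \in E]| = #|nbrs_in W x|.
Proof.
move=> xW.
have -> : [set E in edges_in W | x \in E] = [set [set x; y] | y in nbrs_in W x].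
  apply/setP => E; rewrite !inE; apply/idP/imsetP.
    case/andP=> /andP[/edgeP[a [b [eab ->]]]].
    rewrite subUset !sub1set => /andP[aW bW].
    rewrite !inE => /orP[]/eqP ->; first by exists b; rewrite // inE bW.
    by exists a; rewrite ?inE ?aW 1?e_sym // setUC.
  case=> y; rewrite inE => /andP[yW exy] ->.
  by rewrite mem_edges // subUset !sub1set xW yW !inE eqxx.
apply: card_in_imset => y z; rewrite !inE => /andP[_ exy] /andP[_ exz] eq_yz.
have : y \in [set x; z] by rewrite -eq_yz !inE eqxx orbT.
by rewrite !inE eq_sym (negPf (edge_neq exy)) => /eqP.
Qed.

Lemma degree_edges (x : V) : degree e x = #|[set E in edges e | x \in E]|.
Proof.
transitivity #|nbrs_in setT x|.
  by congr #|pred_of_set _|; apply/setP => y; rewrite !inE.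
rewrite -edges_at ?inE //.
by congr #|pred_of_set _|; apply/setP => E; rewrite !inE subsetT andbT.
Qed.

(** Double counting: both sides count the pairs of a vertex of [A] and a member of [M] containing
    it. *)
Lemma sum_card_at (M : {set {set V}}) (A : {set V}) :
  \sum_(x in A) #|[set E in M | x \in E]| = \sum_(E in M) #|E :&: A|.
Proof.
under eq_bigr do rewrite -sum1_card.
under [RHS]eq_bigr do rewrite -sum1_card.
rewrite (exchange_big_dep (mem M)) /=; last by move=> x E _; rewrite inE => /andP[].
apply: eq_bigr => E EM; apply: eq_bigl => x.
by rewrite !inE EM andbC.
Qed.

(** Checked edge by edge: the number of ends in [A], plus 1 if there are none, equals 1, plus 1 if
    both ends lie in [A]. The additive form avoids truncated subtraction. *)
Lemma sum_degree (A : {set V}) :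
  \sum_(x in A) degree e x + #|edges_in (~: A)| = num_edges e + #|edges_in A|.
Proof.
under eq_bigr do rewrite degree_edges.
have card_in W : #|edges_in W| = \sum_(E in edges e) (E \subset W).
  by rewrite -sum1_card big_mkcond [RHS]big_mkcond; apply: eq_bigr => E _;
     rewrite inE; case: (E \in _); case: (E \subset _).
rewrite sum_card_at !card_in /num_edges -sum1_card -!big_split /=.
apply: eq_bigr => E /edgeP[x [y [/edge_neq xy ->]]].
rewrite !subUset !sub1set !inE -(cardsID [set x] (_ :&: A)).
have -> : [set x; y] :&: A :&: [set x] = if x \in A then [set x] else set0.
  apply/setP => z; case: ifPn => xA; rewrite !inE; case: (eqVneq z x) => [->|] /=;
  by rewrite ?andbF ?andbT // (negPf xA).
have -> : [set x; y] :&: A :\: [set x] = if y \in A then [set y] else set0.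
  apply/setP => z; case: ifPn => yA; rewrite !inE; case: (eqVneq z x) => [->|] /=;
  rewrite ?(negPf xy) //; case: (eqVneq z y) => [->|] //=.
  by rewrite (negPf yA).
by case: (x \in A); case: (y \in A); rewrite ?cards1 ?cards0.
Qed.

(** An edge of [M] not inside [A] has an end outside [A], and disjointness lets each outside vertex
    serve at most one such edge. *)
Lemma card_matching_le (M : {set {set V}}) (A : {set V}) :
  matching e M -> #|M| <= #|edges_in A| + #|~: A|.
Proof.
case/andP=> /subsetP sM tM.
rewrite -(cardsID [set E : {set V} | E \subset A] M) leq_add //.
  apply: subset_leq_card; apply/subsetP => E; rewrite !inE => /andP[EM ->].
  by rewrite sM.
apply: (@leq_trans (\sum_(E in M) #|E :&: ~: A|)).
  rewrite -sum1_card [X in X <= _]big_mkcond [X in _ <= X]big_mkcond.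
  apply: leq_sum => E _; rewrite !inE; case: (E \in M); last by rewrite andbF.
  case: ifP => //; rewrite andbT card_gt0.
  by apply: contraNneq => /eqP; rewrite setI_eq0 disjoints_subset setCK.
rewrite -sum_card_at -sum1_card leq_sum // => x _.
apply/card_le1_eqP => E F; rewrite !inE => /andP[EM xE] /andP[FM xF].
by rewrite -(def_pblock tM EM xE) -(def_pblock tM FM xF).
Qed.

(** * Acyclic graphs: edge count and Koenig's inequality *)

Hypothesis e_acyc : acyclic e.

(* Otherwise a path could be extended at its head forever: a head neighbour
   already on the path, other than the second vertex, would close a cycle. *)
Lemma acyclic_low_degree (W : {set V}) : W != set0 ->
  exists2 x, x \in W & #|nbrs_in W x| <= 1.
Proof.
case/set0Pn=> x0 x0W.
case: (boolP [exists x in W, #|nbrs_in W x| <= 1]) => [/exists_inP //|].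
rewrite negb_exists_in => /forall_inP deg2.
suff long n : exists x p, [/\ path e x p, uniq (x :: p), x \in W & size p = n].
  have [x [p [_ /card_uniqP /= sz _ szp]]] := long #|V|.
  by have := max_card (mem (x :: p)); rewrite sz szp ltnn.
elim: n => [|n [x [p [pp up xW szp]]]]; first by exists x0, [::].
have : 1 < #|nbrs_in W x| by rewrite ltnNge deg2.
(* For empty [p] the head defaults to [x]; in every case at most one of the two or more neighbours
   is removed. *)
rewrite (cardsD1 (head x p)) => nb.
have /set0Pn[z] : nbrs_in W x :\ head x p != set0.
  by rewrite -card_gt0; case: (_ \in _) nb => /=; lia.
rewrite !inE => /and3P[zh zW exz].
have zx : z != x by rewrite eq_sym edge_neq.
case: (boolP (z \in p)) => zp; last first.
  exists z, (x :: p); split; rewrite //=; [|by rewrite inE negb_or zx zp|by rewrite szp].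
  by rewrite e_sym exz.
case/path.splitP: zp pp up zh {szp nb} => p1 p2.
rewrite cat_path -cat_cons cat_uniq => /andP[pp1 _] /and3P[up1 _ _] zh.
(* The segment from [x] to [z] closes up through the edge between them. Since [z] is not the second
   vertex, [p1] is nonempty and the cycle has at least three vertices. *)
case: (e_acyc (c := x :: rcons p1 z)).
  by case: p1 zh {pp1 up1} => [|y p1] /=; rewrite ?eqxx // size_rcons.
by rewrite /ucycle up1 /= andbT rcons_path pp1 last_rcons e_sym.
Qed.

(** By induction on the size of [W]: deleting a vertex of degree at most 1 in [W] loses at most one
    edge. *)
Lemma acyclic_edges_in (W : {set V}) : W != set0 -> #|edges_in W| < #|W|.
Proof.
have [n] := ubnP #|W|; elim: n W => // n IH W ltWn W0.
have [x xW degx] := acyclic_low_degree W0.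
have sz := cardsD1 x W; rewrite xW in sz.
have [W1|W1] := eqVneq (W :\ x) set0.
  rewrite sz W1 cards0 ltnS leqn0 cards_eq0 -subset0.
  apply/subsetP => E; rewrite inE => /andP[/card_edge cE /subset_leq_card].
  by rewrite cE sz W1 cards0.
have ltW : #|W :\ x| < n by lia.
have := IH _ ltW W1; rewrite -(cardsID [set E : {set V} | x \in E] (edges_in W)).
have -> : edges_in W :\: [set E : {set V} | x \in E] = edges_in (W :\ x).
  by apply/setP => E; rewrite !inE subsetD1; case: (x \in E); rewrite ?andbF ?andbT.
have -> : #|edges_in W :&: [set E : {set V} | x \in E]| = #|nbrs_in W x|.
  by rewrite -edges_at //; congr #|pred_of_set _|; apply/setP => E; rewrite !inE.
by move=> lt; rewrite sz -addnS leq_add.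
Qed.

(* A vertex [x] of degree at most 1 goes into the independent set; its
   neighbour, if any, is discarded and matched with [x]. *)
Lemma acyclic_konig_in (W : {set V}) : exists (S : {set V}) (M : {set {set V}}),
  [/\ independent e S, S \subset W, matching e M, cover M \subset W &
      #|W| <= #|S| + #|M|].
Proof.
have [n] := ubnP #|W|; elim: n W => // n IH W ltWn.
have [->|W0] := eqVneq W set0.
  exists set0, set0; split; rewrite ?sub0set ?cards0 //.
  - by apply/forall_inP => x; rewrite inE.
  - by rewrite /matching sub0set; apply/trivIsetP => A B; rewrite inE.
  - by rewrite /cover big_set0 sub0set.
have [x xW degx] := acyclic_low_degree W0.
(* Serves both cases below: [U] is what remains of [W] after deleting [x], together with its
   neighbour if there is one. *)
have indepU (U S : {set V}) : nbrs_in W x \subset ~: U -> U \subset W ->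
    S \subset U -> independent e S -> independent e (x |: S).
  move=> /subsetP nU /subsetP UW /subsetP SU /forall_inP iS.
  have nxS y : y \in S -> ~~ e x y.
    move=> yS; apply/negP => exy; have := nU y.
    by rewrite !inE exy UW ?SU // => /(_ isT).
  apply/forall_inP => a; rewrite !inE => /orP[/eqP ->|aS];
    apply/forall_inP => b; rewrite !inE => /orP[/eqP ->|bS].
  - by rewrite e_irr.
  - exact: nxS.
  - by rewrite e_sym nxS.
  - by have /forall_inP := iS a aS; apply.
have [N0|/set0Pn[y yN]] := eqVneq (nbrs_in W x) set0.
  have sz := cardsD1 x W; rewrite xW in sz.
  have [|S [M [iS SW mM cM le]]] := IH (W :\ x); first by lia.
  exists (x |: S), M; split => //.
  - by apply: (indepU (W :\ x)) => //; rewrite ?N0 ?sub0set ?subsetDl.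
  - by rewrite subUset sub1set xW (subset_trans SW) ?subsetDl.
  - exact: subset_trans cM (subsetDl _ _).
  have xS : x \notin S by apply/negP => /(subsetP SW); rewrite !inE eqxx.
  by rewrite cardsU1 xS; lia.
have Ny z : z \in nbrs_in W x -> z = y.
  by move=> zN; apply: (card_le1_eqP degx).
have [yW exy] : y \in W /\ e x y by move: yN; rewrite inE => /andP.
have sz : #|W| = #|W :\: [set x; y]|.+2.
  rewrite -(cardsID [set x; y] W) (setIidPr _) ?cards2 ?(edge_neq exy) //.
  by rewrite subUset !sub1set xW yW.
have [|S [M [iS SW mM cM le]]] := IH (W :\: [set x; y]); first by lia.
have xyM E : E \in M -> [disjoint [set x; y] & E].
  move=> EM; rewrite disjoint_sym disjoints_subset.
  apply: subset_trans (subset_trans (bigcup_sup E EM) cM) _.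
  by rewrite setDE subsetIr.
exists (x |: S), ([set x; y] |: M); split.
- apply: (indepU (W :\: [set x; y])) => //; last exact: subsetDl.
  by apply/subsetP => z /Ny ->; rewrite !inE eqxx orbT.
- by rewrite subUset sub1set xW (subset_trans SW) ?subsetDl.
- case/andP: mM => sM tM; rewrite /matching subUset sub1set mem_edges // sM /=.
  apply/trivIsetP => A B; rewrite !inE => /orP[/eqP ->|AM] /orP[/eqP ->|BM] //.
  + by rewrite eqxx.
  + by move=> _; apply: xyM.
  + by move=> _; rewrite disjoint_sym; apply: xyM.
  + by apply: (trivIsetP tM).
- apply/bigcupsP => E; rewrite !inE => /orP[/eqP ->|EM].
    by rewrite subUset !sub1set xW yW.
  exact: subset_trans (bigcup_sup E EM) (subset_trans cM (subsetDl _ _)).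
have xS : x \notin S by apply/negP => /(subsetP SW); rewrite !inE eqxx.
have nM : [set x; y] \notin M.
  apply/negP => /xyM; rewrite -setI_eq0 setIid => /eqP/setP/(_ x).
  by rewrite !inE eqxx.
by rewrite !cardsU1 xS nM; lia.
Qed.

Lemma acyclic_konig : #|V| <= independence_number e + matching_number e.
Proof.
have [S [M [iS _ mM _]]] := acyclic_konig_in setT; rewrite cardsT => le.
apply: leq_trans le _; apply: leq_add; first exact: (leq_bigmax_cond _ iS).
exact: (leq_bigmax_cond _ mM).
Qed.

(** * The annihilation number *)

Lemma degree_sequence_prefix (k : nat) : k <= #|V| ->
  exists2 A : {set V}, #|A| = k &
    \sum_(d <- take k (degree_sequence e)) d = \sum_(x in A) degree e x.
Proof.
(* Sorting the vertices by degree, instead of the degrees themselves, turns a prefix into a set of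
   vertices. *)
move=> lek; pose s := sort (relpre (degree e) leq) (enum V).
have us : uniq (take k s) by rewrite take_uniq // sort_uniq enum_uniq.
exists [set x in take k s].
  by rewrite cardsE (card_uniqP us) size_takel // size_sort -cardE.
rewrite /degree_sequence sort_map -map_take big_map -/s big_uniq //=.
by apply: eq_bigl => x; rewrite inE.
Qed.

Lemma acyclic_annihilation_bound : 0 < num_edges e ->
  (annihilation_number e).*2.+1 <= (independence_number e).*2 + matching_number e.
Proof.
move=> m_gt0.
pose P (k : 'I_#|V|.+1) :=
  \sum_(d <- take k (degree_sequence e)) d <= num_edges e.
have [k Pk ->] : {k | P k & annihilation_number e = k}.
  apply: eq_bigmax_cond; apply/card_gt0P; exists ord0.
  by rewrite unfold_in /P take0 big_nil.
have [A cA sumA] := degree_sequence_prefix (leq_ord k).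
move: Pk; rewrite /P sumA => leA; have sdA := sum_degree A.
(* If [A] were all of [V], [sdA] would make its degree sum twice the number of edges, contradicting
   [leA] as there is an edge. *)
have B0 : ~: A != set0.
  apply/eqP => B0; move: sdA; rewrite B0.
  have -> : edges_in set0 = set0.
    apply/setP => E; rewrite !inE subset0; apply/negP => /andP[/card_edge cE /eqP E0].
    by move: cE; rewrite E0 cards0.
  have -> : edges_in A = edges e.
    by apply/setP => E; rewrite inE -[A]setCK B0 setC0 subsetT andbT.
  rewrite cards0 -/(num_edges e); lia.
have ltB := acyclic_edges_in B0.
have mu_le : matching_number e <= #|edges_in A| + #|~: A|.
  by apply/bigmax_leqP => M mM; apply: card_matching_le.
(* With b the size of [~: A] and n that of [V], 2k = 2n - 2b, where n <= alpha + mu and 2b >= mu +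
   1. *)
have := acyclic_konig; have := cardsC A; lia.
Qed.

End Graph.

(** The first step of a path between two distinct vertices is an edge. *)
Lemma connected_has_edge (V : finType) (e : rel V) :
  connected_graph e -> 1 < #|V| -> 0 < num_edges e.
Proof.
move=> [_ con] /card_gt1P[x [y [_ _ xy]]].
have /connectP[[|z p] /= exz lst] := con x y; first by rewrite lst eqxx in xy.
by apply/card_gt0P; exists [set x; z]; apply: mem_edges; case/andP: exz.
Qed.

Local Open Scope ring_scope.

(* The one-vertex tree has a = alpha = 1 and mu = 0, so it violates the bound;
   hence the hypothesis [1 < #|V|]. *)
Theorem theorem2p4 (V : finType) (e : rel V) :
  tree e -> (1 < #|V|)%N ->
  (annihilation_number e)%:R - (independence_number e)%:R
    <= (matching_number e)%:R / 2%:R - 1 / 2%:R :> rat.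
Proof.
move=> [[e_sym e_irr] con acyc] V_gt1.
have := acyclic_annihilation_bound e_sym e_irr acyc (connected_has_edge con V_gt1).
rewrite -(ler_nat rat) -addn1 -!muln2 !natrD !natrM.
lra.
Qed.
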